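(* Let $(\mathcal C,\alpha)$ be a grading category, with the unitors of $\mathrm{Mod}^{\mathcal C}$ the typical ones induced by $\alpha$. If $A$ is a $\mathcal C$-graded algebra, then $\mathrm{Hom}_{\mathrm{Bim}(A,A)^{\mathcal C}}(A,A)$ is isomorphic to the center $Z^{\mathcal C}(A)$ as $\Bbbk$-modules.
   Context: Let $\Bbbk$ be a commutative unital ring with unit group $\Bbbk^\times$ and $\mathcal C$ a small category. A grading category $(\mathcal C,\alpha)$: $\alpha$ assigns to each composable triple $(f_1,f_2,f_3)$ (so $f_3\circ f_2\circ f_1$ is defined) an element of $\Bbbk^\times$ such that for all composable $(f_1,f_2,f_3,f_4)$: $\alpha(f_1,f_2,f_3)\,\alpha(f_1,f_2,f_4\circ f_3)^{-1}\alpha(f_1,f_3\circ f_2,f_4)\,\alpha(f_2\circ f_1,f_3,f_4)^{-1}\alpha(f_2,f_3,f_4)=1$. A $\mathcal C$-graded module is a $\Bbbk$-module $M=\bigoplus_{g\in\mathrm{Mor}(\mathcal C)}M_g$; write $|x|=g$ for $x\in M_g$. $\mathrm{Mod}^{\mathcal C}$ is the category of these with $\Bbbk$-linear maps preserving each $M_g$; $(M\otimes N)_g=\bigoplus_{g=g_2\circ g_1}M_{g_1}\otimes_\Bbbk N_{g_2}$ (products of elements with non-composable degrees are zero). Typical unitor constants: for $g:X\to Y$, $\mathcal L(\mathrm{Id}_X,g)=\alpha(\mathrm{Id}_X,\mathrm{Id}_X,g)^{-1}$, $\mathcal R(g,\mathrm{Id}_Y)=\alpha(g,\mathrm{Id}_Y,\mathrm{Id}_Y)$.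 A $\mathcal C$-graded algebra is a $\mathcal C$-graded module $A$ with a graded $\Bbbk$-linear $\mu:A\otimes A\to A$ (so $|\mu(x,y)|=|y|\circ|x|$) and elements $1_X\in A_{\mathrm{Id}_X}$ for $X\in\mathrm{Ob}(\mathcal C)$ with, for homogeneous elements, $\mu(\mu(x,y),z)=\alpha(|x|,|y|,|z|)\mu(x,\mu(y,z))$, $\mu(1_X,x)=\mathcal L(\mathrm{Id}_X,|x|)x$, $\mu(x,1_Y)=\mathcal R(|x|,\mathrm{Id}_Y)x$ if $|x|:X\to Y$. $\mathrm{Hom}_{\mathrm{Bim}(A,A)^{\mathcal C}}(A,A)$ is the set of graded $\Bbbk$-linear maps $f:A\to A$ with $f(\mu(x,a))=\mu(x,f(a))$ and $f(\mu(a,y))=\mu(f(a),y)$. The center: $Z^{\mathcal C}(A)$ is the $\Bbbk$-module of families (formal sums) $z=\sum_Xz_X$, $z_X\in A_{\mathrm{Id}_X}$ for $X\in\mathrm{Ob}(\mathcal C)$, such that $\mu(a,z)=\zeta(|a|)\mu(z,a)$ for every homogeneous $a\in A$, i.e. $\mu(a,z_Y)=\zeta(|a|)\mu(z_X,a)$ when $|a|:X\to Y$, where $\zeta(g)=\alpha(\mathrm{Id}_X,\mathrm{Id}_X,g)\,\alpha(g,\mathrm{Id}_Y,\mathrm{Id}_Y)$ for $g:X\to Y$. *)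

(* Defs.v *)
From HB Require Import structures.
From mathcomp Require Import all_boot all_order all_algebra.
From mathcomp Require Import all_classical.

Set Implicit Arguments.
Unset Strict Implicit.
Unset Printing Implicit Defensive.

Import GRing.Theory.

Local Open Scope classical_set_scope.
Local Open Scope ring_scope.

(* The unit group of k.  MathComp's GRing.unit is only available on nonzero
   rings with a boolean unit test, whereas k is an arbitrary commutative ring,
   possibly zero. *)
Record units (k : comPzRingType) := Units {
  uval : k;
  uinv : k;
  uvalV : uval * uinv = 1
}.

Definition unitsV (k : comPzRingType) (u : units k) : units k :=
  Units (etrans (mulrC (uinv u) (uval u)) (uvalV u)).

Record category := Category {
  obj :> Type;
  hom : obj -> obj -> Type;
  idc : forall X, hom X X;
  comp : forall X Y Z, hom Y Z -> hom X Y -> hom X Z;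
  comp_idl : forall X Y (f : hom X Y), comp (idc Y) f = f;
  comp_idr : forall X Y (f : hom X Y), comp f (idc X) = f;
  compA : forall X Y Z W (f : hom X Y) (g : hom Y Z) (h : hom Z W),
    comp h (comp g f) = comp (comp h g) f
}.

Notation "g '\oc' f" := (comp g f) (at level 40, left associativity).

(* Mor(C), with the (classical) choice structure needed to index sums. *)
Record mor (C : category) := Mor {
  src : C;
  tgt : C;
  arr : hom src tgt
}.

HB.instance Definition _ (C : category) := gen_eqMixin (mor C).
HB.instance Definition _ (C : category) := gen_choiceMixin (mor C).

(* alpha f1 f2 f3 takes its arguments in diagrammatic order: f3 o f2 o f1 is
   the composite. *)
Record gradingCategory (k : comPzRingType) := GradingCategory {
  gcat :> category;
  alpha : forall (X Y Z W : gcat),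
    hom X Y -> hom Y Z -> hom Z W -> units k;
  alpha_cocycle : forall (X Y Z W V : gcat) (f1 : hom X Y) (f2 : hom Y Z)
      (f3 : hom Z W) (f4 : hom W V),
    uval (alpha f1 f2 f3) * uinv (alpha f1 f2 (f4 \oc f3))
      * uval (alpha f1 (f3 \oc f2) f4) * uinv (alpha (f2 \oc f1) f3 f4)
      * uval (alpha f2 f3 f4) = 1
}.

Section Grading.
Variables (k : comPzRingType) (C : gradingCategory k).

Definition unitorL (X Y : C) (g : hom X Y) : units k :=
  unitsV (alpha (idc X) (idc X) g).

Definition unitorR (X Y : C) (g : hom X Y) : units k :=
  alpha g (idc Y) (idc Y).

Definition zeta (X Y : C) (g : hom X Y) : k :=
  uval (alpha (idc X) (idc X) g) * uval (alpha g (idc Y) (idc Y)).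

(* Internal direct sum: every x is the sum of a unique finitely supported
   family of homogeneous components. *)
Record gradedModule := GradedModule {
  gmod :> lmodType k;
  gpart : mor C -> submodClosed gmod;
  gdirect : forall x : gmod, exists! c : mor C -> gmod,
    [/\ forall g, c g \in gpart g,
        finite_set [set g | c g <> 0]
      & x = \sum_(g \in [set: mor C]) c g]
}.

Definition gradedMap (M N : gradedModule) (f : M -> N) : Prop :=
  linear f /\ forall g x, x \in gpart M g -> f x \in gpart N g.

(* A graded linear map M (x) N -> P, given as a bilinear map: degree g of
   M (x) N is the sum of the M_{g1} (x) N_{g2} over g = g2 o g1, and the
   product of homogeneous elements of non-composable degrees is zero. *)
Definition gradedBimap (M N P : gradedModule) (m : M -> N -> P) : Prop :=
  [/\ forall x, linear (m x),
      forall y, linear (m ^~ y),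
      forall (X Y Z : C) (g1 : hom X Y) (g2 : hom Y Z) x y,
        x \in gpart M (Mor g1) -> y \in gpart N (Mor g2) ->
        m x y \in gpart P (Mor (g2 \oc g1))
    & forall (g1 g2 : mor C) x y, tgt g1 <> src g2 ->
        x \in gpart M g1 -> y \in gpart N g2 -> m x y = 0].

Record gradedAlgebra := GradedAlgebra {
  galg :> gradedModule;
  gmul : galg -> galg -> galg;
  gone : C -> galg;
  gmul_graded : gradedBimap gmul;
  gone_deg : forall X, gone X \in gpart galg (Mor (idc X));
  gmulA : forall (X Y Z W : C) (f : hom X Y) (g : hom Y Z) (h : hom Z W) x y z,
    x \in gpart galg (Mor f) -> y \in gpart galg (Mor g) ->
    z \in gpart galg (Mor h) ->
    gmul (gmul x y) z = uval (alpha f g h) *: gmul x (gmul y z);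
  gmul1l : forall (X Y : C) (f : hom X Y) x, x \in gpart galg (Mor f) ->
    gmul (gone X) x = uval (unitorL f) *: x;
  gmul1r : forall (X Y : C) (f : hom X Y) x, x \in gpart galg (Mor f) ->
    gmul x (gone Y) = uval (unitorR f) *: x
}.

End Grading.

Section HomAndCenter.
Variables (k : comPzRingType) (C : gradingCategory k) (A : gradedAlgebra C).

Lemma gmul_additive :
  [/\ forall x, gmul x 0 = 0 :> A, forall x, gmul 0 x = 0 :> A,
      forall x u v, gmul x (u + v) = gmul x u + gmul x v :> A
    & forall x u v, gmul (u + v) x = gmul u x + gmul v x :> A].
Proof.
have [mulr mull _ _] := gmul_graded A; split=> [x|x|x u v|x u v].
- by have := mulr x (-1) 0 0; rewrite scaler0 addr0 scaleN1r addNr.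
- by have := mull x (-1) 0 0; rewrite scaler0 addr0 scaleN1r addNr.
- by have := mulr x 1 u v; rewrite !scale1r.
- by have := mull x 1 u v; rewrite /= !scale1r.
Qed.

Lemma gmul_scalable :
  (forall x c u, gmul x (c *: u) = c *: gmul x u :> A) /\
  (forall x c u, gmul (c *: u) x = c *: gmul u x :> A).
Proof.
have [mulr mull _ _] := gmul_graded A; have [mul0r mul0l _ _] := gmul_additive.
split=> x c u.
- by have := mulr x c u 0; rewrite !addr0 mul0r addr0.
- by have := mull x c u 0; rewrite /= !addr0 mul0l addr0.
Qed.

(* Hom_{Bim(A,A)^C}(A,A), with pointwise k-module structure. *)
Definition isBimHom : {pred A -> A} := fun f : A -> A => `[<
  [/\ gradedMap f,
      forall x a, f (gmul x a) = gmul x (f a)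
    & forall a y, f (gmul a y) = gmul (f a) y] >].

Lemma isBimHom_closed : subsemimod_closed isBimHom.
Proof.
have [mul0r mul0l mulDr mulDl] := gmul_additive.
have [mulZr mulZl] := gmul_scalable.
split; first split.
- apply/asboolP; split; first split.
  + by move=> c x y; rewrite /= scaler0 addr0.
  + by move=> g x _; exact: rpred0.
  + by move=> x a; rewrite mul0r.
  + by move=> a y; rewrite mul0l.
- move=> f h /asboolP[[fl fg] fr fm] /asboolP[[hl hg] hr hm].
  apply/asboolP; split; first split.
  + by move=> c x y; rewrite !fctE fl hl scalerDr addrACA.
  + by move=> g x gx; rewrite !fctE rpredD ?fg ?hg.
  + by move=> x a; rewrite !fctE fr hr mulDr.
  + by move=> a y; rewrite !fctE fm hm mulDl.
- move=> c f /asboolP[[fl fg] fr fm]; apply/asboolP; split; first split.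
  + by move=> b x y; rewrite !fctE fl scalerDr !scalerA mulrC.
  + by move=> g x gx; rewrite !fctE rpredZ ?fg.
  + by move=> x a; rewrite !fctE fr mulZr.
  + by move=> a y; rewrite !fctE fm mulZl.
Qed.

Record bimHom := BimHom {
  bimHom_fun :> A -> A;
  _ : bimHom_fun \in isBimHom
}.

HB.instance Definition _ := [isSub for bimHom_fun].
HB.instance Definition _ := [Choice of bimHom by <:].
HB.instance Definition _ := GRing.SubChoice_isSubLmodule.Build
  k (A -> A) isBimHom bimHom isBimHom_closed.

(* The formal sum z = sum_X z_X, not necessarily finite, is the family
   X |-> z_X. *)
Definition isCentral : {pred C -> A} := fun z : C -> A => `[<
  (forall X, z X \in gpart A (Mor (idc X))) /\
  forall (X Y : C) (g : hom X Y) a, a \in gpart A (Mor g) ->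
    gmul a (z Y) = zeta g *: gmul (z X) a >].

Lemma isCentral_closed : subsemimod_closed isCentral.
Proof.
have [mul0r mul0l mulDr mulDl] := gmul_additive.
have [mulZr mulZl] := gmul_scalable.
split; first split.
- apply/asboolP; split=> [X|X Y g a _]; first exact: rpred0.
  by rewrite mul0r mul0l scaler0.
- move=> z t /asboolP[zg zc] /asboolP[tg tc]; apply/asboolP.
  split=> [X|X Y g a ga]; first by rewrite !fctE rpredD ?zg ?tg.
  by rewrite !fctE mulDr (zc _ _ g) // (tc _ _ g) // mulDl scalerDr.
- move=> c z /asboolP[zg zc]; apply/asboolP.
  split=> [X|X Y g a ga]; first by rewrite !fctE rpredZ ?zg.
  by rewrite !fctE mulZr (zc _ _ g) // mulZl !scalerA mulrC.
Qed.

Record center := Center {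
  center_fam :> C -> A;
  _ : center_fam \in isCentral
}.

HB.instance Definition _ := [isSub for center_fam].
HB.instance Definition _ := [Choice of center by <:].
HB.instance Definition _ := GRing.SubChoice_isSubLmodule.Build
  k (C -> A) isCentral center isCentral_closed.

End HomAndCenter.

(* Main.v *)
From HB Require Import structures.
From mathcomp Require Import all_boot all_order all_algebra.
From mathcomp Require Import finmap all_classical.
Require Import Defs.

Set Implicit Arguments.
Unset Strict Implicit.
Unset Printing Implicit Defensive.

Import GRing.Theory.

Local Open Scope ring_scope.

(* A bimodule endomorphism f is determined by the family f(1_X), since
   f(a) = alpha(Id_X, Id_X, |a|) mu(f(1_X), a); computing f(a) from 1_X on the
   left and from 1_Y on the right yields the centrality of that family.
   Conversely a central z defines f(a) = alpha(Id_X, Id_X, |a|) mu(z_X, a) on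
   homogeneous a, equivalently alpha(|a|, Id_Y, Id_Y) f(a) = mu(a, z_Y).  Left
   and right bilinearity are the cocycle identities at (Id, Id, f, g) and
   (f, g, Id, Id), and the one at (Id, Id, Id, Id) gives alpha(Id, Id, Id) = 1,
   so that f(1_X) = z_X. *)

Section Cocycle.
Variables (k : comPzRingType) (C : gradingCategory k).

Lemma uinvK (u : units k) : uinv u * uval u = 1.
Proof. by rewrite mulrC uvalV. Qed.

Lemma scale_unitI (V : lmodType k) (u : units k) (x y : V) :
  uval u *: x = uval u *: y -> x = y.
Proof.
by move/(congr1 ( *:%R (uinv u))); rewrite !scalerA uinvK !scale1r.
Qed.

Lemma alpha_id (X : C) : uval (alpha (idc X) (idc X) (idc X)) = 1.
Proof.
have := alpha_cocycle (idc X) (idc X) (idc X) (idc X).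
by rewrite !comp_idl uvalV mul1r uvalV mul1r.
Qed.

(** The third and fourth factors of the cocycle identity at (Id, Id, f, g) are mutually inverse. *)
Lemma alpha_idl_comp (X Y Z : C) (f : hom X Y) (g : hom Y Z) :
  uval (alpha (idc X) (idc X) (g \oc f)) =
  uval (alpha (idc X) (idc X) f) * uval (alpha (idc X) f g).
Proof.
have := alpha_cocycle (idc X) (idc X) f g.
rewrite !comp_idr -mulrA uinvK mulr1 mulrAC => e.
by rewrite -[LHS]mul1r -e -[LHS]mulrA uinvK mulr1.
Qed.

(** The first two factors of the cocycle identity at (f, g, Id, Id) are mutually inverse. *)
Lemma alpha_idr_comp (X Y Z : C) (f : hom X Y) (g : hom Y Z) :
  uval (alpha (g \oc f) (idc Z) (idc Z)) =
  uval (alpha f g (idc Z)) * uval (alpha g (idc Z) (idc Z)).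
Proof.
have := alpha_cocycle f g (idc Z) (idc Z).
rewrite !comp_idl uvalV mul1r mulrAC => e.
by rewrite -[LHS]mul1r -e -[LHS]mulrA uinvK mulr1.
Qed.

End Cocycle.

Section LinearFunctions.
Variables (k : comPzRingType) (M N : lmodType k) (f : M -> N).

Lemma linear_fun0 : linear f -> f 0 = 0.
Proof.
by move=> fl; have := fl (-1) 0 0; rewrite scaler0 addr0 scaleN1r addNr.
Qed.

Lemma linear_funD :
  linear f -> {morph f : x y / x + y}.
Proof. by move=> fl x y; have := fl 1 x y; rewrite !scale1r. Qed.

Lemma linear_funZ c :
  linear f -> {morph f : x / c *: x}.
Proof.
by move=> fl x; have := fl c x 0; rewrite (linear_fun0 fl) !addr0.
Qed.

End LinearFunctions.

Section Homogeneous.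
Variables (k : comPzRingType) (C : gradingCategory k) (M : gradedModule C).

(** Every element is a finite sum of homogeneous ones, so identities between additive maps need
    checking only in each degree. *)
Lemma graded_ind (P : M -> Prop) :
    P 0 -> (forall x y, P x -> P y -> P (x + y)) ->
    (forall g x, x \in gpart M g -> P x) ->
  forall x, P x.
Proof.
move=> P0 PD Ph x; have [c [[ch _ ->] _]] := gdirect x.
by elim/big_ind: _ => // g _; exact: Ph (ch g).
Qed.

(** These are the projections of the direct sum. Linearity comes from uniqueness: combining the
    decompositions of [x] and [y] degreewise decomposes [a *: x + y]. *)
Lemma graded_components : exists d : mor C -> M -> M,
  [/\ forall g, linear (d g),
      forall x, exists S : {fset mor C}, forall g, g \notin S -> d g x = 0
    & forall g x, x \in gpart M g ->
        forall h, d h x = if h == g then x else 0].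
Proof.
have /choice[c cP] : forall x : M, exists c : mor C -> M, unique
    (fun c : mor C -> M => [/\ forall g, c g \in gpart M g,
        finite_set [set g | c g <> 0]%classic
      & x = \sum_(g \in [set: mor C]%classic) c g]) c.
  by move=> x; exact: gdirect x.
have cuniq x c' (S : {fset mor C}) :
    (forall g, c' g \in gpart M g) -> (forall g, g \notin S -> c' g = 0) ->
    x = \sum_(g <- S) c' g -> c x = c'.
  move=> c'h c'0 xE; apply: (cP x).2; split=> //.
    by apply: (finite_subfset S) => g; apply: contra_notT => /c'0.
  by rewrite xE (fsbigTE S).
have csupp x : exists S : {fset mor C}, forall g, g \notin S -> c x g = 0.
  have [[_ cfin _] _] := cP x.
  exists (fset_set [set g | c x g <> 0]%classic) => g.
  by rewrite in_fset_set // notin_setE /= => /contrapT.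
exists (fun g x => c x g); split=> [g a x y||g x gx h] //.
- have [[xh _ xE] _] := cP x; have [[yh _ yE] _] := cP y.
  have [S S0] := csupp x; have [T T0] := csupp y.
  (* The union of both supports serves as a common finite index set for the two sums. *)
  have x0 h : h \notin (S `|` T)%fset -> c x h = 0.
    by rewrite inE negb_or => /andP[/S0].
  have y0 h : h \notin (S `|` T)%fset -> c y h = 0.
    by rewrite inE negb_or => /andP[_ /T0].
  rewrite (@cuniq _ (fun h => a *: c x h + c y h) (S `|` T)%fset) //.
  + by move=> h; rewrite rpredD ?rpredZ.
  + by move=> h hST; rewrite x0 // y0 // scaler0 addr0.
  + by rewrite {1}xE {1}yE !(fsbigTE (S `|` T)%fset) // big_split -scaler_sumr.
- rewrite (@cuniq _ (fun h => if h == g then x else 0) [fset g]%fset) //.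
  + by move=> l; case: eqP => [->|_] //; exact: rpred0.
  + by move=> l; rewrite inE => /negPf->.
  + by rewrite big_seq_fset1 eqxx.
Qed.

(** Universal property of the direct sum: apply [h g] to the degree [g] component and add up. Each
    [h g] is taken on all of [M], though only its values in degree [g] matter. *)
Lemma graded_extension (N : lmodType k) (h : mor C -> M -> N) :
    (forall g, linear (h g)) ->
  exists2 f : M -> N, linear f
    & forall g x, x \in gpart M g -> f x = h g x.
Proof.
move=> hlin; have [d [dlin dsupp dh]] := graded_components.
have h0 g : h g 0 = 0 by exact: linear_fun0.
exists (fun x => \sum_(g \in [set: mor C]%classic) h g (d g x)).
- move=> a x y; have [S S0] := dsupp x; have [T T0] := dsupp y.
  have x0 g : g \notin (S `|` T)%fset -> d g x = 0.
    by rewrite inE negb_or => /andP[/S0].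
  have y0 g : g \notin (S `|` T)%fset -> d g y = 0.
    by rewrite inE negb_or => /andP[_ /T0].
  rewrite !(fsbigTE (S `|` T)%fset) => [||g ST|g ST].
  + rewrite scaler_sumr -big_split; apply: eq_bigr => g _.
    by rewrite dlin hlin.
  + by move=> g ST; rewrite y0.
  + by rewrite x0.
  + by rewrite dlin x0 // y0 // scaler0 addr0.
- move=> g x gx; rewrite (fsbigTE [fset g]%fset) => [|l].
    by rewrite big_seq_fset1 (dh g) // eqxx.
  by rewrite inE (dh g) // => /negPf->.
Qed.

End Homogeneous.

Section Center.
Variables (k : comPzRingType) (C : gradingCategory k) (A : gradedAlgebra C).

Lemma bimHomP (f : bimHom A) :
  [/\ gradedMap f, forall x a, f (gmul x a) = gmul x (f a)
    & forall a y, f (gmul a y) = gmul (f a) y].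
Proof. by case: f => f /= /asboolP. Qed.

Lemma centerP (z : center A) :
  (forall X, z X \in gpart A (Mor (idc X))) /\
  forall (X Y : C) (g : hom X Y) a, a \in gpart A (Mor g) ->
    gmul a (z Y) = zeta g *: gmul (z X) a.
Proof. by case: z => z /= /asboolP. Qed.

Lemma bimHom_central (f : bimHom A) :
  (fun X => f (gone A X)) \in @isCentral k C A.
Proof.
have [[fl fg] fr fm] := bimHomP f; apply/asboolP; split=> [X|X Y g a ga].
  exact/fg/gone_deg.
(* Both sides become multiples of [f a]; in [zeta g] the factor alpha(Id, Id, g) cancels against the
   left unitor. *)
rewrite -fr -fm (gmul1r ga) (gmul1l ga) !(linear_funZ _ fl) scalerA /zeta /=.
by rewrite mulrAC uvalV mul1r.
Qed.

Definition bimHom_center (f : bimHom A) : center A := Center (bimHom_central f).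

Lemma bimHom_center_linear : linear bimHom_center.
Proof. by move=> c f g; apply: val_inj; apply/funext. Qed.

HB.instance Definition _ :=
  GRing.isLinear.Build k (bimHom A) (center A) _ bimHom_center
    bimHom_center_linear.

Lemma bimHom_homogeneous (f : bimHom A) (X Y : C) (g : hom X Y) a :
  a \in gpart A (Mor g) ->
  f a = uval (alpha (idc X) (idc X) g) *: gmul (f (gone A X)) a.
Proof.
have [[fl _] _ fm] := bimHomP f => ga.
by rewrite -fm (gmul1l ga) (linear_funZ _ fl) scalerA uvalV scale1r.
Qed.

Lemma bimHom_center_inj : injective bimHom_center.
Proof.
move=> f f' e; have e1 X : f (gone A X) = f' (gone A X).
  by have := congr1 (fun z : center A => z X) e.
have [[fl _] _ _] := bimHomP f; have [[fl' _] _ _] := bimHomP f'.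
apply: val_inj; apply/funext; elim/(@graded_ind k C A) => [|x y|[X Y g] x gx].
- by rewrite /= (linear_fun0 fl) (linear_fun0 fl').
- by move=> /= ex ey; rewrite (linear_funD fl) (linear_funD fl') ex ey.
- by rewrite /= !(bimHom_homogeneous _ gx) e1.
Qed.

Lemma bimHom_center_surj (z : center A) : exists f, bimHom_center f = z.
Proof.
have [zh zc] := centerP z.
have [mul0r mul0l mulDr mulDl] := gmul_additive A.
have [mulZr mulZl] := gmul_scalable A.
have [_ _ muldeg mulnc] := gmul_graded A.
have [|f fl fE] := @graded_extension k C A A (fun g a =>
    uval (alpha (idc (src g)) (idc (src g)) (arr g)) *: gmul (z (src g)) a).
  by move=> g c x y; rewrite mulDr mulZr scalerDr !scalerA mulrC.
have fEl (X Y : C) (g : hom X Y) a : a \in gpart A (Mor g) ->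
    f a = uval (alpha (idc X) (idc X) g) *: gmul (z X) a by exact: fE.
(* Centrality of [z] enters here: the constants of the left and right descriptions of [f] multiply
   to [zeta g]. *)
have fEr (X Y : C) (g : hom X Y) a : a \in gpart A (Mor g) ->
    uval (alpha g (idc Y) (idc Y)) *: f a = gmul a (z Y).
  by move=> ga; rewrite (fEl _ _ g) // (zc _ _ g) // scalerA mulrC.
have fg g x : x \in gpart A g -> f x \in gpart A g.
  case: g => X Y g gx; rewrite (fEl _ _ g) // rpredZ //.
  by have := muldeg _ _ _ _ _ _ _ (zh X) gx; rewrite comp_idr.
have fr x a : f (gmul x a) = gmul x (f a).
  elim/(@graded_ind k C A): x => [|x y ex ey|[X Y g] x gx].
  - by rewrite !mul0l (linear_fun0 fl).
  - by rewrite !mulDl (linear_funD fl) ex ey.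
  elim/(@graded_ind k C A): a => [|a b ea eb|[Y' Z h] a ha].
  - by rewrite (linear_fun0 fl) !mul0r (linear_fun0 fl).
  - by rewrite (linear_funD fl) !mulDr (linear_funD fl) ea eb.
  (* For non-composable degrees both sides vanish, since [f a] has the degree of [a]. *)
  have [eY|nY] := pselect (Y = Y'); last first.
    by rewrite !(mulnc (Mor g) (Mor h) _ _ nY) ?(linear_fun0 fl) ?fg.
  (* Scaling by this unit allows the right description [fEr] to be used on the product;
     reassociating then moves [z Z] next to [a]. *)
  subst Y'; apply: (@scale_unitI _ _ (alpha (h \oc g) (idc Z) (idc Z))).
  rewrite fEr ?muldeg // (gmulA gx ha (zh Z)) -(fEr _ _ h) // mulZr scalerA.
  by rewrite alpha_idr_comp.
have fm a y : f (gmul a y) = gmul (f a) y.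
  elim/(@graded_ind k C A): a => [|a b ea eb|[X Y g] a ga].
  - by rewrite (linear_fun0 fl) !mul0l (linear_fun0 fl).
  - by rewrite (linear_funD fl) !mulDl (linear_funD fl) ea eb.
  elim/(@graded_ind k C A): y => [|x y ex ey|[Y' Z h] y hy].
  - by rewrite !mul0r (linear_fun0 fl).
  - by rewrite !mulDr (linear_funD fl) ex ey.
  have [eY|nY] := pselect (Y = Y'); last first.
    by rewrite !(mulnc (Mor g) (Mor h) _ _ nY) ?(linear_fun0 fl) ?fg.
  (* Here the left description suits, as [z X] already stands on the side of [a]. *)
  subst Y'; rewrite (fEl _ _ (h \oc g)) ?muldeg // (fEl _ _ g) // mulZl.
  by rewrite (gmulA (zh X) ga hy) scalerA alpha_idl_comp.
have fP : f \in @isBimHom k C A by apply/asboolP.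
exists (BimHom fP); apply: val_inj; apply/funext => X /=.
(* Two scalars appear, one from [f] and one from the right unitor on [z X]; both are alpha(Id, Id,
   Id). *)
rewrite (fEl _ _ (idc X)) ?gone_deg // (gmul1r (zh X)) /= /unitorR.
by rewrite alpha_id !scale1r.
Qed.

End Center.

Theorem proposition4p1 (k : comPzRingType) (C : gradingCategory k)
    (A : gradedAlgebra C) :
  exists phi : {linear bimHom A -> center A}, bijective phi.
Proof.
exists (@bimHom_center k C A).
have [g gK] := choice (@bimHom_center_surj k C A).
by exists g => // f; apply: bimHom_center_inj; rewrite gK.
Qed.
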